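(* Let $(\mathcal{F}_t)$ be a filtration. Let $\varepsilon_t = \sigma_t z_t$ with $\sigma_t = \exp(H_t)$, $H_t = \bar{H}_t + h_t$, where $\bar{H}_t = E\{H_t\mid\mathcal{F}_{t-1}\}$ is $\mathcal{F}_{t-1}$-measurable, $(h_t)$ is i.i.d. with Laplace density $\frac{1}{2\Delta}\exp(-|x|/\Delta)$, $\Delta = E|h_t|>0$, and $(z_t)$ is i.i.d. $\mathcal{N}(0,1)$, with $z_t$, $h_t$ mutually independent and independent of $\mathcal{F}_{t-1}$. For $\Lambda > 0$ put $\widetilde{\Lambda}_t = \Lambda/(\sqrt{2}e^{\bar{H}_t})$. Then $$P\{|\varepsilon_t| \ge \Lambda \mid \mathcal{F}_{t-1}\} = \frac{1}{2\sqrt{\pi}}\left(\gamma\!\left(\frac{1+1/\Delta}{2}, \widetilde{\Lambda}_t^2\right)\widetilde{\Lambda}_t^{-1/\Delta} - \Gamma\!\left(\frac{1-1/\Delta}{2}, \widetilde{\Lambda}_t^2\right)\widetilde{\Lambda}_t^{1/\Delta}\right) + \operatorname{erfc}(\widetilde{\Lambda}_t).$$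
   Context: $\Gamma(a,b) = \int_b^\infty x^{a-1}e^{-x}\,dx$ (upper incomplete gamma function), $\gamma(a,b) = \int_0^b x^{a-1}e^{-x}\,dx$ (lower incomplete gamma function), and $\operatorname{erfc}(x) = \frac{2}{\sqrt{\pi}}\int_x^\infty e^{-u^2}\,du$ is the complementary error function. *)

(* Defs.v *)
From HB Require Import structures.
From mathcomp Require Import all_boot all_order all_algebra.
From mathcomp Require Import all_classical all_reals all_analysis.
Set Implicit Arguments. Unset Strict Implicit. Unset Printing Implicit Defensive.
Import Order.TTheory GRing.Theory Num.Theory.
Import numFieldNormedType.Exports.
Local Open Scope classical_set_scope.
Local Open Scope ring_scope.

Section Defs.
Variable R : realType.

Definition upper_gamma (a b : R) : R :=
  Rintegral lebesgue_measure `[b, +oo[%classic (fun x => x `^ (a - 1) * expR (- x)).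

Definition lower_gamma (a b : R) : R :=
  Rintegral lebesgue_measure `[0, b]%classic (fun x => x `^ (a - 1) * expR (- x)).

Definition erfc (x : R) : R :=
  2 / Num.sqrt pi * Rintegral lebesgue_measure `[x, +oo[%classic (fun u => expR (- (u ^+ 2))).

Definition laplace_pdf (Delta x : R) : R := (2 * Delta)^-1 * expR (- (`|x| / Delta)).

Definition gauss_pdf (x : R) : R := (Num.sqrt (2 * pi))^-1 * expR (- (x ^+ 2 / 2)).

Definition thm22_rhs (Delta Lt : R) : R :=
  (2 * Num.sqrt pi)^-1 *
    (lower_gamma ((1 + Delta^-1) / 2) (Lt ^+ 2) * Lt `^ (- Delta^-1)
     - upper_gamma ((1 - Delta^-1) / 2) (Lt ^+ 2) * Lt `^ (Delta^-1))
  + erfc Lt.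

End Defs.

(* Main.v *)
(** Freezing the F-measurable Hbar, the event has conditional probability
    P(e^h |z| >= M) with M = Lambda / e^Hbar = sqrt 2 * Lt. Integrating out h
    first, its Laplace tail makes this the Gaussian mean of (|z| / M)^(1/Delta) / 2
    where |z| <= M and of 1 - (M / |z|)^(1/Delta) / 2 where |z| >= M. Both are
    truncated moments of a Gaussian, which x = y^2 / 2 turns into incomplete
    gamma functions; the constant 1 contributes the erfc term. *)
Require Import Defs.
From HB Require Import structures.
From mathcomp Require Import all_boot all_order all_algebra.
From mathcomp Require Import all_classical all_reals all_analysis.
From mathcomp Require Import measurable_realfun ring lra.
Import Order.TTheory GRing.Theory Num.Theory.
Import numFieldNormedType.Exports.
Local Open Scope classical_set_scope.
Local Open Scope ring_scope.

(** * Independence and densities *)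

Section Density.
Context d (T : measurableType d) {R : realType}.
Local Open Scope ereal_scope.

(** A [mu]-null set has null integral, so [nu] is dominated by [mu]. Then [p] and the Radon-Nikodym
    derivative have equal integrals over every measurable set, hence agree almost everywhere. *)
Lemma ge0_integral_density (mu : {sigma_finite_measure set T -> \bar R})
    (nu : {finite_measure set T -> \bar R}) (p : T -> R) (f : T -> \bar R) :
  measurable_fun setT p -> (forall x, 0 <= p x)%R ->
  (forall A, measurable A -> nu A = \int[mu]_(x in A) (p x)%:E) ->
  measurable_fun setT f -> (forall x, 0 <= f x) ->
  \int[nu]_x f x = \int[mu]_x (f x * (p x)%:E).
Proof.
move=> mp p0 nuE mf f0.
have mpE : measurable_fun setT (EFin \o p) by exact/measurable_EFinP.
have numu : nu `<< mu.
  apply/null_content_dominatesP => A mA A0.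
  rewrite nuE//; apply: null_set_integral => //; exact: measurable_funTS.
have ip : mu.-integrable setT (EFin \o p).
  apply/integrableP; split => //.
  under eq_integral do rewrite gee0_abs ?lee_fin//.
  by rewrite -nuE// ltey_eq fin_num_measure.
rewrite -(Radon_Nikodym_SigmaFinite.change_of_variables numu)//.
apply: ae_eq_integral => //.
- apply: emeasurable_funM => //.
  exact: measurable_int (Radon_Nikodym_SigmaFinite.f_integrable numu).
- exact: emeasurable_funM.
- apply: ae_eqe_mul2l; apply: integral_ae_eq => //.
    exact: Radon_Nikodym_SigmaFinite.f_integrable.
  move=> E _ mE; rewrite -nuE//.
  exact/esym/(Radon_Nikodym_SigmaFinite.f_integral numu).
Qed.
End Density.

(** Taken over finite measures because it is applied to the restriction of [P] to an event, whose
    mass need not be 1. *)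
Definition law d d' (T : measurableType d) (T' : measurableType d') (R : realType)
    (mu : {finite_measure set T -> \bar R}) (X : {mfun T >-> T'}) :=
  pushforward mu X.
Arguments law {d d' T T' R}.

Section Law.
Context d d' (T : measurableType d) (T' : measurableType d') (R : realType).
Variables (mu : {finite_measure set T -> \bar R}) (X : {mfun T >-> T'}).

Let law0 : law mu X set0 = 0%E. Proof. exact: measure0. Qed.

Let law_ge0 A : (0 <= law mu X A)%E. Proof. exact: measure_ge0. Qed.

Let law_sigma_additive : semi_sigma_additive (law mu X).
Proof. exact: measure_semi_sigma_additive. Qed.

HB.instance Definition _ := isMeasure.Build _ _ _ (law mu X)
  law0 law_ge0 law_sigma_additive.

Let law_fin : fin_num_fun (law mu X).
Proof.
move=> B mB; apply: fin_num_measure.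
by rewrite -[X in measurable X]setTI; exact: measurable_funP.
Qed.

HB.instance Definition _ := @Measure_isFinite.Build _ _ _ (law mu X) law_fin.
End Law.

Section Product.
Context d (T : measurableType d) {R : realType}.
Local Open Scope ereal_scope.
Context d1 d2 (T1 : measurableType d1) (T2 : measurableType d2).

(** Rectangles determine a finite measure on the product. The factors are finite measures, so that
    one of them can carry the mass of a conditioning event. *)
Lemma joint_law (mu : {finite_measure set T -> \bar R})
    (X : {mfun T >-> T1}) (Y : {mfun T >-> T2})
    (m1 : {finite_measure set T1 -> \bar R})
    (m2 : {finite_measure set T2 -> \bar R}) :
  (forall B C, measurable B -> measurable C ->
    mu (X @^-1` B `&` Y @^-1` C) = m1 B * m2 C) ->
  forall S, measurable S ->
  mu ((fun w => (X w, Y w)) @^-1` S) = (m1 \x m2) S.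
Proof.
move=> XY S mS.
have mXY : measurable_fun setT (fun w => (X w, Y w)).
  by apply/measurable_fun_pair; exact: measurable_funP.
pose XYf : {mfun T >-> (T1 * T2)%type} :=
  HB.pack (fun w => (X w, Y w)) (isMeasurableFun.Build _ _ _ _ _ mXY).
by rewrite (@product_measure_unique _ _ _ _ _ m1 m2 (law mu XYf) XY).
Qed.

Lemma product_measure12 (m1 : {finite_measure set T1 -> \bar R})
    (m2 : {finite_measure set T2 -> \bar R}) S :
  measurable S -> (m1 \x m2) S = (m1 \x^ m2) S.
Proof.
by move=> mS; apply: product_measure_unique => // A B mA mB; exact: product_measure2E.
Qed.

Lemma ge0_integral_mrestr (mu : {measure set T -> \bar R}) (A : set T)
    (mA : measurable A) (f : T -> \bar R) :
  measurable_fun setT f -> (forall x, 0 <= f x) ->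
  \int[mrestr mu mA]_x f x = \int[mu]_(x in A) f x.
Proof.
move=> mf f0; rewrite -(setUv A) ge0_integral_setU//=; last 3 first.
- exact: measurableC.
- by rewrite setUv.
- exact/disj_setPCl.
rewrite [X in _ + X]null_set_integral ?adde0//=; last 3 first.
- exact: measurableC.
- exact: measurable_funTS.
- by rewrite /mrestr setICl measure0.
by apply: eq_measure_integral => B mB BA; rewrite /= /mrestr setIidl.
Qed.

End Product.

(** * Freezing a variable measurable for the conditioning sigma-algebra *)

Section Conditioning.
Local Open Scope ereal_scope.
Context d (T : measurableType d) {R : realType} (P : probability T R).
Context d1 d2 d3 (T1 : measurableType d1) (T2 : measurableType d2)
  (T3 : measurableType d3).

(** Under [P] restricted to an event of [F], the pair [(Y, Z)] keeps its product law up to the mass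
    of the event. Applied to [A] cut with events of [X], this makes [X] independent of [(Y, Z)]
    under [P] restricted to [A], and the sections of [S] can be integrated. The form [\x^] makes the
    law of [Y] the inner one. *)
Lemma prob_freezing (F : set (set T)) (X : {mfun T >-> T1}) (Y : {mfun T >-> T2})
    (Z : {mfun T >-> T3}) :
  sigma_algebra setT F -> F `<=` measurable ->
  (forall B, measurable B -> F (X @^-1` B)) ->
  (forall A B C, F A -> measurable B -> measurable C ->
    P (A `&` Y @^-1` B `&` Z @^-1` C) = P A * P (Y @^-1` B) * P (Z @^-1` C)) ->
  forall A S, F A -> measurable S ->
  P (A `&` [set w | S (X w, (Y w, Z w))]) =
  \int[P]_(w in A) (distribution P Y \x^ distribution P Z) (xsection S (X w)).
Proof.
move=> sF Fm FX ind A S FA mS.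
have FI B C : F B -> F C -> F (B `&` C).
  have [_ _ _ FI] := (sigma_algebraP (fun X (_ : F X) => @subsetT _ X)).1 sF.
  exact: FI.
have mA : measurable A by exact: Fm.
have mYZ : measurable_fun setT (fun w => (Y w, Z w)).
  by apply/measurable_fun_pair; exact: measurable_funP.
pose YZ : {mfun T >-> (T2 * T3)%type} :=
  HB.pack (fun w => (Y w, Z w)) (isMeasurableFun.Build _ _ _ _ _ mYZ).
pose PYZ := (distribution P Y \x^ distribution P Z).
have indYZ B D : F B -> measurable D -> P (B `&` YZ @^-1` D) = P B * PYZ D.
  move=> FB mD; have mB : measurable B by exact: Fm.
  (* The mass of [B] goes into the first factor, as a scaling of the law of [Y]. *)
  have PB0 : (0 <= fine (P B))%R by rewrite fine_ge0.
  have jl : mrestr P mB (YZ @^-1` D) =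
      (mscale (NngNum PB0) (distribution P Y) \x distribution P Z) D.
    apply: joint_law => // B' C mB' mC.
    transitivity (P (B `&` Y @^-1` B' `&` Z @^-1` C)).
      by rewrite -setIA [in RHS]setIC.
    by rewrite ind// -[in LHS](fineK (fin_num_measure P B mB)).
  transitivity (mrestr P mB (YZ @^-1` D)); first by rewrite setIC.
  rewrite jl /PYZ -product_measure12//=.
  rewrite /product_measure1 ge0_integral_mscale//=; last first.
    exact: measurable_fun_xsection.
  by rewrite (fineK (fin_num_measure P B mB)).
have jl : mrestr P mA ((fun w => (X w, YZ w)) @^-1` S) =
    (law (mrestr P mA) X \x PYZ) S.
  apply: joint_law => // B D mB mD.
  transitivity (P ((A `&` X @^-1` B) `&` YZ @^-1` D)).
    rewrite /= /mrestr; congr (P _); rewrite setIC setIA //.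
  rewrite indYZ//; last by apply: FI => //; exact: FX.
  by rewrite /law /pushforward/= /mrestr [in RHS]setIC.
transitivity (mrestr P mA ((fun w => (X w, YZ w)) @^-1` S)); first by rewrite setIC.
rewrite jl /= /product_measure1.
have mS' : measurable_fun setT (PYZ \o xsection S) by exact: measurable_fun_xsection.
rewrite /law ge0_integral_pushforward//=.
rewrite ge0_integral_mrestr//.
exact: (measurableT_comp mS' (measurable_funP X)).
Qed.
End Conditioning.

(** * Incomplete gamma functions and truncated Gaussian moments *)

Section IntegrableScale.
Context d (T : measurableType d) {R : realType} (nu : {measure set T -> \bar R}).

Lemma integrable_scale (A : set T) (c : R) (f : T -> R) : measurable A ->
  nu.-integrable A (EFin \o f) -> nu.-integrable A (EFin \o (fun y => c * f y)).
Proof. by move=> mA fi; exact: (integrableZl mA c fi). Qed.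

Lemma integrable_sub (A : set T) (f g : T -> R) : measurable A ->
  nu.-integrable A (EFin \o f) -> nu.-integrable A (EFin \o g) ->
  nu.-integrable A (EFin \o (fun y => f y - g y)).
Proof. by move=> mA fi gi; exact: (integrableB mA fi gi). Qed.

End IntegrableScale.

(** * Exhausting, splitting and folding intervals *)

Section IntervalIntegrals.
Context {R : realType}.
Local Notation mu := (@lebesgue_measure R).

Lemma bigcup_itvcc_left (u : nat -> R) (b : R) : (forall n, 0 < u n) ->
  (forall x, 0 < x -> exists n, u n <= x) ->
  \bigcup_n `[u n, b]%classic = `]0, b]%classic.
Proof.
move=> u0 uc; apply/seteqP; split=> x /=.
  by case=> n _; rewrite /= !in_itv/= => /andP[/(lt_le_trans (u0 n)) -> ->].
rewrite in_itv/= => /andP[x0 xb]; have [n un] := uc _ x0.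
by exists n => //=; rewrite in_itv/= un.
Qed.

Lemma bigcup_itvcc_right (u : nat -> R) (a : R) :
  (forall x, exists n, x <= u n) ->
  \bigcup_n `[a, u n]%classic = `[a, +oo[%classic.
Proof.
move=> uc; apply/seteqP; split=> x /=.
  by case=> n _; rewrite /= !in_itv/= => /andP[->].
rewrite in_itv/= andbT => ax; have [n un] := uc x.
by exists n => //=; rewrite in_itv/= un ax.
Qed.

(** Monotone convergence on both sides; this carries a substitution formula from compact intervals
    to the interval they exhaust. *)
Lemma integral_bigcup_nondecreasing (A B : (set R)^nat) (f g : R -> \bar R) :
  nondecreasing_seq A -> nondecreasing_seq B ->
  (forall n, measurable (A n)) -> (forall n, measurable (B n)) ->
  measurable_fun setT f -> measurable_fun setT g ->
  (forall x, 0 <= f x)%E -> (forall x, 0 <= g x)%E ->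
  (forall n, \int[mu]_(x in A n) f x = \int[mu]_(x in B n) g x)%E ->
  (\int[mu]_(x in \bigcup_n A n) f x = \int[mu]_(x in \bigcup_n B n) g x)%E.
Proof.
move=> ndA ndB mA mB mf mg f0 g0 fg.
have cf : (\int[mu]_(x in A n) f x)%E @[n --> \oo] -->
    (\int[mu]_(x in \bigcup_n A n) f x)%E.
  by apply: ge0_nondecreasing_set_cvg_integral => // n; exact: measurable_funTS.
have cg : (\int[mu]_(x in B n) g x)%E @[n --> \oo] -->
    (\int[mu]_(x in \bigcup_n B n) g x)%E.
  by apply: ge0_nondecreasing_set_cvg_integral => // n; exact: measurable_funTS.
rewrite -(cvg_lim _ cf)// -(cvg_lim _ cg)//.
by under eq_fun do rewrite fg.
Qed.

Lemma ge0_integral_itvU (a x y : itv_bound R) (f : R -> \bar R) :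
  (a <= x)%O -> (x <= y)%O -> measurable_fun setT f -> (forall t, 0 <= f t)%E ->
  (\int[mu]_(t in [set` Interval a y]) f t =
   \int[mu]_(t in [set` Interval a x]) f t + \int[mu]_(t in [set` Interval x y]) f t)%E.
Proof.
move=> ax xy mf f0; rewrite (itv_bndbnd_setU ax xy) ge0_integral_setU//=.
- exact: measurable_funTS.
- apply/disj_setPS => t /= [].
  rewrite !itv_boundlr => /andP[_ tx] /andP[xt _].
  by have := le_trans tx xt; rewrite bnd_simp ltxx.
Qed.

Lemma ge0_integralT_even (f : R -> \bar R) : measurable_fun setT f ->
  (forall x, 0 <= f x)%E -> (forall x, f (- x) = f x) ->
  (\int[mu]_x f x = 2%:E * \int[mu]_(x in `[0%R, +oo[) f x)%E.
Proof.
move=> mf f0 fN; rewrite -set_itvNyy (@ge0_integral_itvU _ (BLeft 0))//.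
rewrite integral_itv_bndo_bndc; last exact: measurable_funTS.
rewrite mule_natl mule2n; congr (_ + _)%E.
by rewrite ge0_integration_by_substitution0//; apply: eq_integral => x _; rewrite fN.
Qed.

Lemma EFin_Rintegral (A : set R) (f : R -> R) : measurable A ->
  mu.-integrable A (EFin \o f) ->
  (\int[mu]_(x in A) (f x)%:E = ((\int[mu]_(x in A) f x)%R)%:E)%E.
Proof. by move=> mA fi; rewrite /Rintegral fineK// integrable_fin_num. Qed.

End IntervalIntegrals.

(** * Quadratic substitution in the gamma integrals *)

Section Gamma.
Context {R : realType}.
Local Notation mu := (@lebesgue_measure R).

Lemma measurable_powR_expR (p c : R) :
  measurable_fun setT (fun y : R => y `^ p * expR (- (c * y ^+ 2))).
Proof.
apply: measurable_funM; first exact: measurable_powR.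
apply: measurableT_comp => //; apply: measurableT_comp => //.
by apply: measurable_funM => //; exact: measurable_funX.
Qed.

Lemma measurable_gamma_integrand (p : R) :
  measurable_fun setT (fun x : R => x `^ p * expR (- x)).
Proof.
by apply: measurable_funM; [exact: measurable_powR|exact: measurableT_comp].
Qed.

Lemma derive1_scale_sqr (c : R) :
  (fun y : R => c * y ^+ 2)^`()%classic = (fun y => 2 * c * y).
Proof.
apply/funext => y; rewrite derive1E derive_val.
by rewrite /GRing.scale/=; ring.
Qed.

(** The power in the gamma integrand times the derivative of [c * y ^+ 2]; the exponent of [y] is
    [2 * (s - 1) + 1]. *)
Lemma powR_scale_sqr (s c y : R) : 0 < c -> 0 < y ->
  (c * y ^+ 2) `^ (s - 1) * (2 * c * y) = 2 * c `^ s * y `^ (2 * s - 1).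
Proof.
move=> c0 y0; rewrite -powR_mulrn ?ltW// powRM ?powR_ge0 ?ltW// -powRrM.
rewrite (_ : 2 * s - 1 = 2%:R * (s - 1) + 1); last by ring.
rewrite [in RHS]powRD; last by apply/implyP => _; rewrite gt_eqF.
rewrite powRr1 ?ltW//.
have -> : c `^ s = c `^ (s - 1) * c.
  rewrite -[in LHS](subrK 1 s) [LHS]powRD; last by apply/implyP => _; rewrite gt_eqF.
  by rewrite powRr1 ?ltW.
ring.
Qed.

(** The interval stays away from 0, so the integrand is continuous on it whatever the sign of
    [s - 1]. Later [c = 1/2] yields the Gaussian weight and [c = 1] that of [erfc]. *)
Lemma gamma_substitution (s c a b : R) : 0 < c -> 0 < a -> a <= b ->
  (\int[mu]_(x in `[(c * a ^+ 2)%R, (c * b ^+ 2)%R])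
     (x `^ (s - 1) * expR (- x))%:E =
   \int[mu]_(y in `[a, b])
     (2 * c `^ s * (y `^ (2 * s - 1) * expR (- (c * y ^+ 2))))%:E)%E.
Proof.
move=> c0 a0 ab.
have cF : continuous (fun y : R => c * y ^+ 2).
  move=> y; apply: differentiable_continuous; apply/derivable1_diffP.
  exact: ex_derive.
have cF' : continuous (fun y : R => 2 * c * y).
  move=> y; apply: differentiable_continuous; apply/derivable1_diffP.
  exact: ex_derive.
rewrite (@integration_by_substitution_increasing _ (fun y => c * y ^+ 2)
  (fun x => x `^ (s - 1) * expR (- x)))//.
- apply: eq_integral => y; rewrite inE/= in_itv/= => /andP[ay _].
  have y0 := lt_le_trans a0 ay.
  by rewrite !fctE derive1_scale_sqr mulrAC powR_scale_sqr// mulrA.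
- move=> x y; rewrite !in_itv/= => /andP[ax _] /andP[ay _] xy.
  rewrite ltr_pM2l// ltr_pXn2r// nnegrE; first exact: le_trans (ltW a0) ax.
  exact: le_trans (ltW a0) ay.
- by rewrite derive1_scale_sqr => x _; exact: cF'.
- rewrite derive1_scale_sqr; apply: cvgP; apply: cvg_at_right_filter; exact: cF'.
- rewrite derive1_scale_sqr; apply: cvgP; apply: cvg_at_left_filter; exact: cF'.
- split; first by move=> x _; exact: ex_derive.
  + by apply: cvg_at_right_filter; exact: cF.
  + by apply: cvg_at_left_filter; exact: cF.
- apply: continuous_in_subspaceT => x; rewrite inE/= in_itv/= => /andP[ax _].
  have x0 : 0 < x by apply: lt_le_trans ax; rewrite mulr_gt0// exprn_gt0.
  apply: differentiable_continuous; apply/derivable1_diffP/derivableM.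
    by apply: derivable_powR; rewrite in_itv/= x0.
  exact: ex_derive.
Qed.

Lemma upper_gamma_substitution (s c a : R) : 0 < c -> 0 < a ->
  (\int[mu]_(x in `[(c * a ^+ 2)%R, +oo[) (x `^ (s - 1) * expR (- x))%:E =
   \int[mu]_(y in `[a, +oo[)
     (2 * c `^ s * (y `^ (2 * s - 1) * expR (- (c * y ^+ 2))))%:E)%E.
Proof.
move=> c0 a0; pose u n : R := a * n.+1%:R.
have au n : a <= u n by rewrite /u ler_peMr ?ler1n// ltW.
have ndu n m : (n <= m)%N -> u n <= u m by move=> nm; rewrite /u ler_pM2l// ler_nat.
have u0 n : 0 < u n by exact: lt_le_trans (au n).
rewrite -(@bigcup_itvcc_right _ (fun n => c * u n ^+ 2) (c * a ^+ 2)); last first.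
  (* This [n] gives [x <= c * a ^+ 2 * n.+1], and [n.+1 <= n.+1 ^+ 2] does the rest. *)
  move=> x; exists (Num.trunc (x / (c * a ^+ 2))).
  have ca0 : 0 < c * a ^+ 2 by rewrite mulr_gt0// exprn_gt0.
  have := ltW (truncnS_gt (x / (c * a ^+ 2))).
  rewrite ler_pdivrMr// => /le_trans; apply.
  rewrite /u exprMn [leLHS]mulrC [leRHS]mulrA ler_pM2l//.
  by rewrite expr2 ler_peMr// ?ler1n// ler0n.
rewrite -(@bigcup_itvcc_right _ u); last first.
  move=> x; exists (Num.trunc (x / a)).
  by have := ltW (truncnS_gt (x / a)); rewrite /u ler_pdivrMr// mulrC.
apply: integral_bigcup_nondecreasing.
- move=> n m nm; apply/subsetPset => x /=; rewrite !in_itv/=.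
  move=> /andP[-> /le_trans]; apply.
  by rewrite ler_pM2l// ler_sqr ?ndu// nnegrE ltW.
- move=> n m nm; apply/subsetPset => x /=; rewrite !in_itv/=.
  move=> /andP[-> /le_trans]; apply.
  exact: ndu.
- by move=> n; exact: measurable_itv.
- by move=> n; exact: measurable_itv.
- by apply/measurable_EFinP; exact: measurable_gamma_integrand.
- by apply/measurable_EFinP/measurable_funM => //; exact: measurable_powR_expR.
- by move=> x; rewrite lee_fin mulr_ge0 ?powR_ge0 ?expR_ge0.
- by move=> x; rewrite lee_fin !mulr_ge0 ?powR_ge0 ?expR_ge0.
- by move=> n; exact: gamma_substitution.
Qed.

Lemma lower_gamma_substitution (s c b : R) : 0 < c -> 0 < b ->
  (\int[mu]_(x in `[0%R, (c * b ^+ 2)%R]) (x `^ (s - 1) * expR (- x))%:E =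
   \int[mu]_(y in `[0%R, b])
     (2 * c `^ s * (y `^ (2 * s - 1) * expR (- (c * y ^+ 2))))%:E)%E.
Proof.
move=> c0 b0; pose u n : R := b / n.+1%:R.
have ub n : u n <= b by rewrite /u ler_pdivrMr ?ltr0n// ler_peMr ?ler1n// ltW.
have ndu n m : (n <= m)%N -> u m <= u n.
  by move=> nm; rewrite /u ler_pM2l// lef_pV2 ?posrE ?ltr0n// ler_nat.
have u0 n : 0 < u n by rewrite divr_gt0.
have mf : measurable_fun setT (fun x : R => (x `^ (s - 1) * expR (- x))%:E).
  by apply/measurable_EFinP; exact: measurable_gamma_integrand.
have mg : measurable_fun setT
    (fun y : R => (2 * c `^ s * (y `^ (2 * s - 1) * expR (- (c * y ^+ 2))))%:E).
  by apply/measurable_EFinP/measurable_funM => //; exact: measurable_powR_expR.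
(* The null set at 0 is dropped on both sides, since the compact intervals exhaust only the
   half-open ones. *)
rewrite -integral_itv_obnd_cbnd; last exact: measurable_funTS.
rewrite -[RHS]integral_itv_obnd_cbnd; last exact: measurable_funTS.
rewrite -(@bigcup_itvcc_left _ (fun n => c * u n ^+ 2) (c * b ^+ 2)); last 2 first.
- by move=> n; rewrite mulr_gt0// exprn_gt0.
(* With [N = n.+1] this gives [c * b ^+ 2 <= x * N], hence at most [x * N ^+ 2]. *)
- move=> x x0; exists (Num.trunc (c * b ^+ 2 / x)).
  have := ltW (truncnS_gt (c * b ^+ 2 / x)).
  set N := (_.+1%:R : R); rewrite ler_pdivrMr// => cbN.
  have N1 : 1 <= N by rewrite ler1n.
  have N0 : 0 < N by rewrite ltr0n.
  rewrite /u -/N exprMn exprVn mulrA ler_pdivrMr ?exprn_gt0// (le_trans cbN)//.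
  by rewrite [leLHS]mulrC ler_pM2l// expr2 ler_peMr// ltW.
rewrite -(@bigcup_itvcc_left _ u)//; last first.
  move=> x x0; exists (Num.trunc (b / x)).
  have := ltW (truncnS_gt (b / x)).
  by rewrite /u !ler_pdivrMr ?ltr0n// mulrC.
apply: integral_bigcup_nondecreasing => //.
- move=> n m nm; apply/subsetPset => x /=; rewrite !in_itv/= => /andP[ux ->].
  by rewrite (le_trans _ ux)// ler_pM2l// ler_sqr ?ndu// nnegrE ltW.
- move=> n m nm; apply/subsetPset => x /=; rewrite !in_itv/= => /andP[ux ->].
  by rewrite (le_trans _ ux)// ndu.
- by move=> x; rewrite lee_fin mulr_ge0 ?powR_ge0 ?expR_ge0.
- by move=> x; rewrite lee_fin !mulr_ge0 ?powR_ge0 ?expR_ge0.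
- by move=> n; exact: gamma_substitution.
Qed.

End Gamma.

(** * Truncated moments of the Gaussian weight *)

Section GaussianMoments.
Context {R : realType}.
Local Notation mu := (@lebesgue_measure R).

Lemma gauss_pdfE : @gauss_pdf R = normal_pdf 0 1.
Proof.
apply/funext => x; rewrite normal_pdfE ?oner_eq0// /gauss_pdf /normal_peak /normal_fun.
rewrite expr1n mul1r subr0 mulr_natl; congr (_ * expR _).
by rewrite mulNr.
Qed.

(** Domination by a multiple of the standard normal density; the square root in [k] undoes its
    normalisation. *)
Lemma integrable_powR_gauss (A : set R) (p C : R) : measurable A ->
  (forall y, A y -> y `^ p <= C) ->
  mu.-integrable A (EFin \o (fun y => y `^ p * expR (- (2^-1 * y ^+ 2)))).
Proof.
move=> mA yC; pose k : R := C * Num.sqrt (2 * pi).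
have i1 : mu.-integrable A (fun x => k%:E * (normal_pdf 0 1 x)%:E)%E.
  apply: integrableZl => //; apply: integrableS (integrable_normal_pdf 0 1) => //.
apply: le_integrable i1 => //.
  apply: measurable_funTS; apply/measurable_EFinP; exact: measurable_powR_expR.
move=> y Ay; rewrite -EFinM !abse_EFin lee_fin -gauss_pdfE /gauss_pdf.
rewrite (le_trans _ (ler_norm _))// ger0_norm ?mulr_ge0 ?powR_ge0 ?expR_ge0//.
rewrite [leRHS]mulrA /k mulfK; last by rewrite gt_eqF// sqrtr_gt0 mulr_gt0// pi_gt0.
by rewrite [_ / 2]mulrC ler_pM2r ?expR_gt0// yC.
Qed.

Lemma integrable_lower_moment (p M : R) : 0 <= p ->
  mu.-integrable `[0, M] (EFin \o (fun y => y `^ p * expR (- (2^-1 * y ^+ 2)))).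
Proof.
move=> p0; apply: (@integrable_powR_gauss _ _ (M `^ p)) => // y /=.
rewrite in_itv/= => /andP[y0 yM]; apply: ge0_ler_powR => //.
by rewrite nnegrE (le_trans y0).
Qed.

(** A nonpositive power is nonincreasing on the positive half-line, so its value at [M] bounds it
    beyond [M]. *)
Lemma integrable_upper_moment (p M : R) : p <= 0 -> 0 < M ->
  mu.-integrable `[M, +oo[ (EFin \o (fun y => y `^ p * expR (- (2^-1 * y ^+ 2)))).
Proof.
move=> p0 M0; apply: (@integrable_powR_gauss _ _ (M `^ p)) => // y /=.
rewrite in_itv/= andbT => My; have y0 := lt_le_trans M0 My.
have powVN t : t `^ p = (t `^ (- p))^-1 by rewrite powRN invrK.
rewrite !powVN lef_pV2 ?posrE ?powR_gt0//.
by apply: ge0_ler_powR; rewrite ?oppr_ge0// nnegrE ltW.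
Qed.

(** Unnormalised moments, with the weight written as the quadratic substitution produces it at
    [c = 1/2]. *)
Definition lower_moment (p M : R) :=
  (\int[mu]_(y in `[0, M]) (y `^ p * expR (- (2^-1 * y ^+ 2))))%R.
Definition upper_moment (p M : R) :=
  (\int[mu]_(y in `[M, +oo[) (y `^ p * expR (- (2^-1 * y ^+ 2))))%R.

(** Puts the constant of the substitution in base [Num.sqrt 2], the base that also appears in the
    threshold [Num.sqrt 2 * L]. *)
Lemma half_powR (s : R) : 2^-1 `^ s = Num.sqrt 2 `^ (- (2 * s)) :> R.
Proof.
rewrite -powR12_sqrt// -powRrM -[in LHS]powR_inv1// -powRrM.
by congr (_ `^ _); field.
Qed.

(** The substitution with [c = 1/2] sends [Num.sqrt 2 * L] to [L ^+ 2], and [s = (1 + p) / 2] makes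
    the exponent [2 * s - 1] equal to [p]. *)
Lemma lower_gamma_moment (p L : R) : 0 <= p -> 0 < L ->
  lower_gamma ((1 + p) / 2) (L ^+ 2) =
  2 * (Num.sqrt 2 `^ (- (1 + p)) * lower_moment p (Num.sqrt 2 * L)).
Proof.
move=> p0 L0; have r0 : 0 < Num.sqrt (2 : R) by rewrite sqrtr_gt0.
rewrite /lower_gamma /lower_moment.
have -> : L ^+ 2 = 2^-1 * (Num.sqrt 2 * L) ^+ 2.
  by rewrite exprMn sqr_sqrtr// mulrA mulVf// mul1r.
rewrite /Rintegral lower_gamma_substitution ?invr_gt0 ?mulr_gt0//.
have -> : 2 * ((1 + p) / 2) - 1 = p by field.
rewrite half_powR (_ : - (2 * ((1 + p) / 2)) = - (1 + p)); last by field.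
rewrite mulrA; apply: RintegralZl => //; exact: integrable_lower_moment.
Qed.

Lemma upper_gamma_moment (q L : R) : 0 <= q -> 0 < L ->
  upper_gamma ((1 - q) / 2) (L ^+ 2) =
  2 * (Num.sqrt 2 `^ (- (1 - q)) * upper_moment (- q) (Num.sqrt 2 * L)).
Proof.
move=> q0 L0; have r0 : 0 < Num.sqrt (2 : R) by rewrite sqrtr_gt0.
rewrite /upper_gamma /upper_moment.
have -> : L ^+ 2 = 2^-1 * (Num.sqrt 2 * L) ^+ 2.
  by rewrite exprMn sqr_sqrtr// mulrA mulVf// mul1r.
rewrite /Rintegral upper_gamma_substitution ?invr_gt0 ?mulr_gt0//.
have -> : 2 * ((1 - q) / 2) - 1 = - q by field.
rewrite half_powR (_ : - (2 * ((1 - q) / 2)) = - (1 - q)); last by field.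
rewrite mulrA; apply: RintegralZl => //; apply: integrable_upper_moment.
- by rewrite oppr_le0.
- by rewrite mulr_gt0.
Qed.

(* [1 - 0] puts this in the shape of [upper_gamma_moment] at [q = 0]. *)
Lemma erfc_upper_gamma (L : R) : 0 < L ->
  erfc L = (Num.sqrt pi)^-1 * upper_gamma ((1 - 0) / 2) (L ^+ 2).
Proof.
move=> L0; rewrite /erfc /upper_gamma /Rintegral.
(* The inserted factor 1 selects the substitution [x = y ^+ 2], whose exponent [2 * s - 1] vanishes
   here. *)
rewrite -[in RHS](mul1r (L ^+ 2)) upper_gamma_substitution//.
rewrite (_ : 2 * ((1 - 0) / 2) - 1 = 0); last by field.
transitivity ((Num.sqrt pi)^-1 *
    (\int[mu]_(y in `[L, +oo[) (2 * gauss_fun y))%R); last first.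
  congr (_ * fine _); apply: eq_integral => y _.
  by rewrite powR1 powRr0 mulr1 !mul1r.
rewrite RintegralZl//; last exact: integrableS (@integrableT_gauss R).
by rewrite mulrCA mulrA.
Qed.

(** Brings the three special functions to one threshold [M], in the shape that integrating against
    the Gaussian density produces; [erfc] becomes the moment of order 0. *)
Lemma thm22_rhs_moments (Delta L : R) : 0 < Delta -> 0 < L ->
  let M := Num.sqrt 2 * L in
  thm22_rhs Delta L = (Num.sqrt (2 * pi))^-1 *
    (M `^ (- Delta^-1) * lower_moment Delta^-1 M
     + (2 * upper_moment 0 M - M `^ Delta^-1 * upper_moment (- Delta^-1) M)).
Proof.
move=> D0 L0 M; have r0 : 0 < Num.sqrt (2 : R) by rewrite sqrtr_gt0.
have p0 : 0 <= Delta^-1 by rewrite invr_ge0 ltW.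
have spi0 : Num.sqrt pi != 0 :> R by rewrite gt_eqF// sqrtr_gt0 pi_gt0.
rewrite /thm22_rhs erfc_upper_gamma// lower_gamma_moment// !upper_gamma_moment//.
rewrite oppr0 -/M sqrtrM// /M !powRM ?ltW//.
set I := lower_moment _ _; set J := upper_moment (- _) _; set K := upper_moment 0 _.
have rD a b : Num.sqrt (2 : R) `^ (a + b) = Num.sqrt 2 `^ a * Num.sqrt 2 `^ b.
  by rewrite powRD//; apply/implyP => _; rewrite gt_eqF.
rewrite !opprB !opprD !rD.
rewrite !powRN powRr0 invr1 powRr1 ?ltW//.
(* With exponent sums split, the remaining real powers can be treated as unknown positive numbers,
   leaving a rational identity. *)
have := powR_gt0 Delta^-1 r0; move: (_ `^ _) => rp rp0.
have := powR_gt0 Delta^-1 L0; move: (L `^ _) => Lp Lp0.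
field.
by rewrite spi0 !gt_eqF.
Qed.

End GaussianMoments.

(** * The Laplace-Gauss mixture *)

Section GaussMixture.
Context {R : realType}.
Local Notation mu := (@lebesgue_measure R).

(** Here [g y] stands for the exceedance probability over [h] when [z = y]. Evenness folds the line
    onto the positive half, which is split at [M]; both formulas for [g] give 1/2 there. *)
Lemma gauss_mixture (Delta L : R) (g : R -> \bar R) : 0 < Delta -> 0 < L ->
  let M := Num.sqrt 2 * L in
  measurable_fun setT g -> (forall y, 0 <= g y)%E -> (forall y, g (- y) = g y) ->
  (forall y, 0 <= y <= M -> g y = (2^-1 * (y / M) `^ Delta^-1)%:E) ->
  (forall y, M <= y -> g y = (1 - 2^-1 * (M / y) `^ Delta^-1)%:E) ->
  (\int[mu]_y (g y * (gauss_pdf y)%:E) = (thm22_rhs Delta L)%:E)%E.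
Proof.
move=> D0 L0 M mg g0 gN gM Mg; have p0 : 0 <= Delta^-1 by rewrite invr_ge0 ltW.
have M0 : 0 < M by rewrite mulr_gt0// sqrtr_gt0.
pose k : R := (Num.sqrt (2 * pi))^-1.
have mpdf : measurable_fun setT (EFin \o @gauss_pdf R).
  by apply/measurable_EFinP; rewrite gauss_pdfE; exact: measurable_normal_pdf.
have mf : measurable_fun setT (fun y => g y * (gauss_pdf y)%:E)%E.
  exact: emeasurable_funM.
have f0 y : (0 <= g y * (gauss_pdf y)%:E)%E.
  by rewrite mule_ge0// lee_fin gauss_pdfE normal_pdf_ge0.
rewrite ge0_integralT_even//; last by move=> x; rewrite gN /gauss_pdf sqrrN.
rewrite (@ge0_integral_itvU _ _ (BLeft M))//; last by rewrite bnd_simp ltW.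
rewrite integral_itv_bndo_bndc; last exact: measurable_funTS.
have il := @integrable_lower_moment _ Delta^-1 M p0.
have iu0 := @integrable_upper_moment _ 0 M (lexx 0) M0.
have iun : mu.-integrable `[M, +oo[
    (EFin \o (fun y => y `^ (- Delta^-1) * expR (- (2^-1 * y ^+ 2)))).
  by apply: integrable_upper_moment; rewrite ?oppr_le0.
have -> : (\int[mu]_(y in `[0%R, M]) (g y * (gauss_pdf y)%:E) =
    (k / 2 * M `^ (- Delta^-1) * lower_moment Delta^-1 M)%:E)%E.
  rewrite /lower_moment -RintegralZl// -EFin_Rintegral//; last exact: integrable_scale.
  apply: eq_integral => y; rewrite inE/= in_itv/= => /andP[y0 yM].
  rewrite gM ?y0// -EFinM /gauss_pdf -/k powRM ?invr_ge0 ?(ltW M0)//.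
  rewrite powRN -[M^-1]powR_inv1 ?(ltW M0)// -powRrM mulN1r powRN.
  by rewrite [_ / 2 in LHS]mulrC; congr (_%:E); ring.
have -> : (\int[mu]_(y in `[M, +oo[) (g y * (gauss_pdf y)%:E) =
    (k * upper_moment 0 M - k / 2 * M `^ Delta^-1 * upper_moment (- Delta^-1) M)%:E)%E.
  rewrite /upper_moment -!RintegralZl// -RintegralB//; [|exact: integrable_scale..].
  rewrite -EFin_Rintegral//; last first.
    by apply: integrable_sub; [|exact: integrable_scale..].
  apply: eq_integral => y; rewrite inE/= in_itv/= andbT => My.
  have y0 := lt_le_trans M0 My.
  rewrite Mg// -EFinM /gauss_pdf -/k powRM ?invr_ge0 ?(ltW M0) ?(ltW y0)//.
  rewrite powRr0 powRN -[y^-1]powR_inv1 ?(ltW y0)// -powRrM mulN1r powRN.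
  rewrite [_ / 2 in LHS]mulrC; congr (_%:E); field.
  by rewrite gt_eqF ?powR_gt0.
(* The 2 from folding the line cancels the halves in [g] and doubles the moment of order 0. *)
by rewrite thm22_rhs_moments// -/M -/k -EFinD -EFinM; congr (_%:E); field.
Qed.

End GaussMixture.

(** * Laplace tails and the exceedance probability given the Gaussian value *)

Section Laplace.
Context {R : realType}.
Local Notation mu := (@lebesgue_measure R).

Variable Delta : R.
Hypothesis D0 : 0 < Delta.

Lemma laplace_pdf_ge0 x : 0 <= laplace_pdf Delta x.
Proof. by rewrite mulr_ge0 ?expR_ge0// invr_ge0 mulr_ge0// ltW. Qed.

Lemma continuous_laplace_pdf : continuous (laplace_pdf Delta).
Proof.
move=> x; rewrite /laplace_pdf; apply: cvgM; first exact: cvg_cst.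
apply: (cvg_comp _ expR); last exact: continuous_expR.
apply: cvgN; apply: cvgM; last exact: cvg_cst.
exact: norm_continuous.
Qed.

Lemma laplace_tail_ge0 c : 0 <= c ->
  (\int[mu]_(x in `[c, +oo[) (laplace_pdf Delta x)%:E =
   (2^-1 * expR (- (c / Delta)))%:E)%E.
Proof.
move=> c0; pose G (x : R) := - (2^-1 * expR (- (x / Delta))).
have cG : continuous G.
  move=> x; apply: differentiable_continuous; apply/derivable1_diffP.
  exact: ex_derive.
rewrite (@ge0_continuous_FTC2y _ _ G _ 0)//.
- by rewrite sub0e EFinN oppeK.
- by move=> x _; exact: laplace_pdf_ge0.
- exact/continuous_subspaceT/continuous_laplace_pdf.
- rewrite -oppr0 -(mulr0 2^-1); apply: cvgN; apply: cvgM; first exact: cvg_cst.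
  apply: (@cvg_comp _ _ _ (fun x => x / Delta) (fun x => expR (- x)) _
    (pinfty_nbhs R)); last exact: cvgr_expR.
  by apply: gt0_cvgMly; rewrite ?invr_gt0.
- by apply: cvg_at_right_filter; exact: cG.
- move=> x; rewrite in_itv/= andbT => cx.
  rewrite derive1E derive_val /laplace_pdf ger0_norm ?(le_trans c0 (ltW cx))//.
  rewrite /GRing.scale/= invfM; ring.
Qed.

(** The half-line from 0 contributes 1/2; on the negative side the density has antiderivative [G],
    half of [expR (x / Delta)]. *)
Lemma laplace_tail_le0 c : c <= 0 ->
  (\int[mu]_(x in `[c, +oo[) (laplace_pdf Delta x)%:E =
   (1 - 2^-1 * expR (c / Delta))%:E)%E.
Proof.
(* The case [c = 0] is separate because the fundamental theorem is applied on a nondegenerate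
   interval. *)
rewrite le_eqVlt => /predU1P[->|c0].
  by rewrite laplace_tail_ge0// mul0r oppr0 expR0; congr (_%:E); lra.
have mf : measurable_fun setT (EFin \o laplace_pdf Delta).
  apply/measurable_EFinP; apply: continuous_measurable_fun.
  exact: continuous_laplace_pdf.
rewrite (@ge0_integral_itvU _ _ (BLeft 0))//; last 2 first.
- by rewrite bnd_simp ltW.
- by move=> x; rewrite lee_fin laplace_pdf_ge0.
rewrite laplace_tail_ge0// integral_itv_bndo_bndc; last exact: measurable_funTS.
pose G (x : R) := 2^-1 * expR (x / Delta).
have cG : continuous G.
  move=> x; apply: differentiable_continuous; apply/derivable1_diffP.
  exact: ex_derive.
rewrite (@continuous_FTC2 _ _ G)//.
- rewrite -EFinB -EFinD /G !mul0r oppr0 expR0; congr (_%:E); lra.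
- exact/continuous_subspaceT/continuous_laplace_pdf.
- split; first by move=> x _; exact: ex_derive.
  + by apply: cvg_at_right_filter; exact: cG.
  + by apply: cvg_at_left_filter; exact: cG.
- move=> x; rewrite in_itv/= => /andP[_ x0].
  rewrite derive1E derive_val /laplace_pdf ltr0_norm// mulNr opprK.
  rewrite /GRing.scale/= invfM; ring.
Qed.
End Laplace.

(** The modulus increases with [x], so taking logarithms turns the event into a half-line. *)
Lemma exceedance_itv {R : realType} (Lambda b y : R) : 0 < Lambda -> y != 0 ->
  [set x | Lambda <= `|expR (b + x) * y|] =
  `[ln (Lambda / expR b / `|y|), +oo[%classic.
Proof.
move=> L0 y0; have ny0 : 0 < `|y| by rewrite normr_gt0.
apply/funext => x /=; rewrite in_itv/= andbT normrM ger0_norm ?expR_ge0//.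
rewrite -[in RHS]ler_expR lnK ?posrE ?divr_gt0 ?expR_gt0// expRD.
rewrite !ler_pdivrMr ?expR_gt0//; congr (is_true (_ <= _)); ring.
Qed.

(** The half-line starts at [ln (M / y)], whose sign depends on whether [y] is below or above [M]
    and so selects the tail formula; exponentials of logarithms become powers. *)
Lemma laplace_exceedance {R : realType} (Delta Lambda b y : R) :
  0 < Delta -> 0 < Lambda ->
  let M := Lambda / expR b in
  let E := [set x | Lambda <= `|expR (b + x) * y|] in
  (0 <= y <= M ->
    (\int[lebesgue_measure]_(x in E) (laplace_pdf Delta x)%:E =
      (2^-1 * (y / M) `^ Delta^-1)%:E)%E) /\
  (M <= y ->
    (\int[lebesgue_measure]_(x in E) (laplace_pdf Delta x)%:E =
      (1 - 2^-1 * (M / y) `^ Delta^-1)%:E)%E).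
Proof.
move=> D0 L0 M E; have M0 : 0 < M by rewrite divr_gt0// expR_gt0.
have [y0|y0] := leP y 0.
  split=> [/andP[y0' _]|My]; last by have := lt_le_trans M0 My; rewrite ltNge y0.
  have -> : y = 0 by apply/eqP; rewrite eq_le y0 y0'.
  (* At [y = 0] the event is empty, matching the value 0 of a power of 0 with nonzero exponent. *)
  rewrite mul0r powR0 ?gt_eqF ?invr_gt0// mulr0 (_ : E = set0) ?integral_set0//.
  apply/seteqP; split=> // x; rewrite /E/=.
  have -> : y = 0 by apply/eqP; rewrite eq_le y0 y0'.
  by rewrite mulr0 normr0 leNgt L0.
rewrite /E exceedance_itv ?gt_eqF// gtr0_norm// -/M.
have My0 : 0 < M / y by rewrite divr_gt0.
have powE : (M / y) `^ Delta^-1 = expR (ln (M / y) / Delta).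
  by rewrite /powR gt_eqF// mulrC.
split=> [/andP[_ yM]|My].
- rewrite laplace_tail_ge0//; last by rewrite ln_ge0// ler_pdivlMr// mul1r.
  by rewrite expRN -powE -[y / M]invf_div -(powR_inv1 (ltW My0)) -powRrM mulN1r powRN.
- by rewrite laplace_tail_le0// -?powE// ln_le0// ler_pdivrMr// mul1r.
Qed.

(** Conditional probability is expressed by its defining integral identity, tested on every event of
    the sigma-algebra. *)
Theorem theorem2p2 (R : realType) (d : measure_display) (T : measurableType d)
  (P : probability T R)
  (F : set (set T))                 (* F = F_{t-1} *)
  (Hbar h z : T -> R) (Delta Lambda : R) :
  sigma_algebra setT F ->
  F `<=` measurable ->
  (forall B : set R, measurable B -> F (Hbar @^-1` B)) ->
  measurable_fun setT h ->
  measurable_fun setT z ->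
  0 < Delta ->
  (forall B : set R, measurable B ->
     P (h @^-1` B) = (\int[lebesgue_measure]_(x in B) (laplace_pdf Delta x)%:E)%E) ->
  (forall B : set R, measurable B ->
     P (z @^-1` B) = (\int[lebesgue_measure]_(x in B) (gauss_pdf x)%:E)%E) ->
  (forall (A : set T) (B C : set R), F A -> measurable B -> measurable C ->
     P (A `&` h @^-1` B `&` z @^-1` C) =
       (P A * P (h @^-1` B) * P (z @^-1` C))%E) ->
  0 < Lambda ->
  let eps := fun w => expR (Hbar w + h w) * z w in
  let Lt := fun w => Lambda / (Num.sqrt 2 * expR (Hbar w)) in
  forall A : set T, F A ->
    P (A `&` [set w | Lambda <= `|eps w|]) =
      (\int[P]_(w in A) (thm22_rhs Delta (Lt w))%:E)%E.
Proof.
move=> sF Fm FH mh mz D0 hE zE ind L0 eps Lt A FA.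
have mH : measurable_fun setT Hbar.
  by move=> _ B mB; rewrite setTI; exact/Fm/FH.
pose X : {mfun T >-> R} := HB.pack Hbar (isMeasurableFun.Build _ _ _ _ _ mH).
pose Y : {mfun T >-> R} := HB.pack h (isMeasurableFun.Build _ _ _ _ _ mh).
(* [lebesgue_measure] lives on [measurableTypeR R], whose display differs from
   that of [R]; the density of [z] with respect to it needs this codomain. *)
pose Z : {mfun T >-> measurableTypeR R} :=
  HB.pack z (isMeasurableFun.Build _ _ _ (measurableTypeR R) _ mz).
pose f (t : R * (R * measurableTypeR R)) := `|expR (t.1 + t.2.1) * t.2.2|.
have mf : measurable_fun setT f.
  have m2 : measurable_fun setT (fun t : R * (R * measurableTypeR R) => t.2).
    exact: measurable_snd.
  apply: measurableT_comp => //; apply: measurable_funM.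
    apply: measurableT_comp => //; apply: measurable_funD => //.
    exact: (measurableT_comp (@measurable_fst _ _ _ _) m2).
  exact: (measurableT_comp (@measurable_snd _ _ _ _) m2).
pose S : set (R * (R * measurableTypeR R)) := f @^-1` `[Lambda, +oo[%classic.
have mS : measurable S by rewrite -[S]setTI; apply: mf.
have SE t : S t = (Lambda <= f t) :> Prop by rewrite /S/= in_itv/= andbT.
transitivity (P (A `&` [set w | S (X w, (Y w, Z w))])).
  by congr (P (A `&` _)); apply/seteqP; split=> w; rewrite /= SE.
rewrite (@prob_freezing _ _ _ P _ _ _ _ _ _ F X Y Z sF Fm FH ind A S FA mS).
(* From here [w] is fixed and [Hbar] is the constant [b]. *)
apply: eq_integral => w _; set b := Hbar w.
have Lt0 : 0 < Lt w by rewrite divr_gt0// mulr_gt0 ?sqrtr_gt0// expR_gt0.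
have ME : Num.sqrt 2 * Lt w = Lambda / expR b.
  rewrite /Lt -/b; field.
  by rewrite !gt_eqF ?expR_gt0 ?sqrtr_gt0.
rewrite /product_measure2.
pose D := xsection S b.
have mD : measurable D by exact: measurable_xsection.
have mg := @measurable_fun_ysection _ _ _ _ _ (distribution P Y) D mD.
rewrite (@ge0_integral_density _ _ _ lebesgue_measure (distribution P Z)
  (@gauss_pdf R))//; last 2 first.
- by rewrite gauss_pdfE; exact: measurable_normal_pdf.
- by move=> x; rewrite gauss_pdfE normal_pdf_ge0.
have DE y : ysection D y = [set x | Lambda <= `|expR (b + x) * y|].
  by apply/seteqP; split=> x; rewrite /ysection /D /xsection/= !inE/= in_setE SE.
have gE y : distribution P Y (ysection D y) =
    (\int[lebesgue_measure]_(x in [set x | (Lambda <= `|expR (b + x) * y|)%R])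
      (laplace_pdf Delta x)%:E)%E.
  by rewrite /distribution /pushforward/= hE DE// -DE; exact: measurable_ysection.
apply: gauss_mixture => //.
- move=> y; rewrite /= !DE; congr (_ _).
  by apply/seteqP; split=> x/=; rewrite mulrN normrN.
- move=> y yM; rewrite /= gE.
  have [+ _] := laplace_exceedance Delta Lambda b y D0 L0; rewrite -ME; exact.
- move=> y My; rewrite /= gE.
  have [_ +] := laplace_exceedance Delta Lambda b y D0 L0; rewrite -ME; exact.
Qed.
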